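(* The group $\Gamma$ with 4 generators and 3 relations defined by the presentation \[ \Gamma:=\langle x,y,z,t\mid xyz,\ xzy,\ xt^{-1}yt^{-1}zt^{-1}\rangle \] has the Haagerup property.
   Context: A countable discrete group has the Haagerup property (is a-T-menable) if it admits a metrically proper affine isometric action on a Hilbert space. *)

(* Defs.v *)
From HB Require Import structures.
From mathcomp Require Import all_boot all_order all_algebra.
From mathcomp Require Import all_classical all_reals all_analysis.

Set Implicit Arguments.
Unset Strict Implicit.
Unset Printing Implicit Defensive.

Import Order.TTheory GRing.Theory Num.Theory.
Import numFieldNormedType.Exports.

Local Open Scope classical_set_scope.
Local Open Scope quotient_scope.

(* The letter (a, false) stands for the generator a, (a, true) for its inverse. *)
Definition word (X : choiceType) := seq (X * bool).

Definition linv (X : choiceType) (l : X * bool) : X * bool := (l.1, ~~ l.2).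

Definition winv (X : choiceType) (w : word X) : word X := rev (map (@linv X) w).

(* The least monoid congruence on words that cancels adjacent inverse letters
   and kills the relators: its quotient is the group < X | rels >. *)
Inductive word_eq (X : choiceType) (rels : seq (word X)) : word X -> word X -> Prop :=
| word_eq_refl u : word_eq rels u u
| word_eq_sym u v : word_eq rels u v -> word_eq rels v u
| word_eq_trans u v w : word_eq rels u v -> word_eq rels v w -> word_eq rels u w
| word_eq_cat u u' v v' :
    word_eq rels u u' -> word_eq rels v v' -> word_eq rels (u ++ v) (u' ++ v')
| word_eq_cancel l : word_eq rels [:: l; linv l] [::]
| word_eq_relator r : r \in rels -> word_eq rels r [::].

Section PresentedGroup.
Variables (X : choiceType) (rels : seq (word X)).

Definition word_eqb (u v : word X) : bool := `[< word_eq rels u v >].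

Lemma word_eqb_equiv : equiv_class_of word_eqb.
Proof.
split=> [u|u v|v u w].
- exact/asboolP/word_eq_refl.
- by apply/asboolP/asboolP; apply: word_eq_sym.
- by move=> /asboolP uv /asboolP vw; apply/asboolP; apply: word_eq_trans uv vw.
Qed.

Canonical word_equiv := EquivRelPack word_eqb_equiv.

Definition presented_group := {eq_quot word_equiv}.

HB.instance Definition _ := EqQuotient.on presented_group.
HB.instance Definition _ := Choice.on presented_group.

Definition pg_one : presented_group := \pi_presented_group ([::] : word X).
Definition pg_mul (a b : presented_group) : presented_group :=
  \pi_presented_group (repr a ++ repr b).
Definition pg_inv (a : presented_group) : presented_group :=
  \pi_presented_group (winv (repr a)).

Lemma pg_piP (u v : word X) :
  reflect (word_eq rels u v)
    (\pi_presented_group u == \pi_presented_group v).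
Proof. by rewrite eqmodE; exact: asboolP. Qed.

Lemma pg_repr (u : word X) : word_eq rels (repr (\pi_presented_group u)) u.
Proof. by apply/pg_piP; rewrite reprK. Qed.

Lemma linvK : involutive (@linv X).
Proof. by case=> a b; rewrite /linv /= negbK. Qed.

Lemma winvK : involutive (@winv X).
Proof.
by move=> w; rewrite /winv map_rev revK -map_comp (eq_map linvK) map_id.
Qed.

Lemma word_eq_mulV (w : word X) : word_eq rels (w ++ winv w) [::].
Proof.
elim: w => [|l w IH]; first exact: word_eq_refl.
rewrite /winv /= rev_cons -cats1 -[rev _]/(winv w) catA -cat1s.
apply: word_eq_trans (word_eq_cancel rels l).
have IHl := word_eq_cat (word_eq_refl rels [:: l]) IH.
by have := word_eq_cat IHl (word_eq_refl rels [:: linv l]); rewrite -!catA.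
Qed.

Lemma pg_mulA : associative pg_mul.
Proof.
move=> a b c; apply/eqP/pg_piP.
apply: word_eq_trans (word_eq_cat (word_eq_refl _ _) (pg_repr _)) _.
rewrite catA; apply: word_eq_sym.
exact: word_eq_cat (pg_repr _) (word_eq_refl _ _).
Qed.

Lemma pg_mul1 : left_id pg_one pg_mul.
Proof.
move=> a; rewrite -[RHS]reprK; apply/eqP/pg_piP.
exact: word_eq_cat (pg_repr _) (word_eq_refl _ _).
Qed.

Lemma pg_mulr1 : right_id pg_one pg_mul.
Proof.
move=> a; rewrite -[RHS]reprK; apply/eqP/pg_piP.
rewrite -[X in word_eq _ _ X]cats0.
exact: word_eq_cat (word_eq_refl _ _) (pg_repr _).
Qed.

Lemma pg_mulV : left_inverse pg_one pg_inv pg_mul.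
Proof.
move=> a; apply/eqP/pg_piP.
apply: word_eq_trans (word_eq_cat (pg_repr _) (word_eq_refl _ _)) _.
by rewrite -{2}[repr a]winvK; exact: word_eq_mulV.
Qed.

Lemma pg_mulrV : right_inverse pg_one pg_inv pg_mul.
Proof.
move=> a; apply/eqP/pg_piP.
apply: word_eq_trans (word_eq_cat (word_eq_refl _ _) (pg_repr _)) _.
exact: word_eq_mulV.
Qed.

HB.instance Definition _ :=
  isGroup.Build presented_group pg_mulA pg_mul1 pg_mulr1 pg_mulV pg_mulrV.

End PresentedGroup.

Definition generator (X : choiceType) (a : X) : word X := [:: (a, false)].

Local Open Scope ring_scope.

Section Haagerup.
Variable R : realType.

(* [dot] is an inner product inducing the norm of H. *)
Definition hilbert (H : completeNormedModType R) (dot : {dot H for idfun}) :=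
  forall v : H, `|v| ^+ 2 = dot v v.

Definition group_action (G : groupType) (T : Type) (alpha : G -> T -> T) :=
  (forall v, alpha 1%g v = v) /\
  (forall g h v, alpha (g * h)%g v = alpha g (alpha h v)).

Definition affine_map (H : lmodType R) (f : H -> H) :=
  exists (A : {linear H -> H}) (b : H), forall v, f v = A v + b.

Definition isometric_map (H : normedModType R) (f : H -> H) :=
  forall v w, `|f v - f w| = `|v - w|.

Definition metrically_proper (G : groupType) (H : normedModType R)
    (alpha : G -> H -> H) :=
  forall B : set H, bounded_set B ->
    finite_set [set g : G | (alpha g @` B) `&` B !=set0].

(* Metric properness forces G to be countable, so that countability need not
   be assumed; Hilbert spaces are real, as is usual for affine actions. *)
Definition haagerup (G : groupType) :=
  exists (H : completeNormedModType R) (dot : {dot H for idfun})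
         (alpha : G -> H -> H),
    [/\ hilbert dot,
        group_action alpha,
        forall g, affine_map (alpha g) /\ isometric_map (alpha g)
      & metrically_proper alpha].

End Haagerup.

Definition Gamma : groupType :=
  let x : word 'I_4 := generator (@Ordinal 4 0 isT) in
  let y : word 'I_4 := generator (@Ordinal 4 1 isT) in
  let z : word 'I_4 := generator (@Ordinal 4 2 isT) in
  let t : word 'I_4 := generator (@Ordinal 4 3 isT) in
  presented_group
    [:: x ++ y ++ z;
        x ++ z ++ y;
        x ++ winv t ++ y ++ winv t ++ z ++ winv t].

(* Main.v *)
Require Import Defs.
From HB Require Import structures.
From mathcomp Require Import all_boot all_order all_algebra.
From mathcomp Require Import all_classical all_reals all_analysis.
From mathcomp Require Import ring lra zify.

(* With [w = x y^-1] and [s = t^-1] the relators say that [x] commutes with [w]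
   and that the conjugates [s_l = x^l s x^-l] satisfy
   [s_l s_(l+1) = w^-1 s_(l+2)^-1 w]; this recurrence can be solved in both
   directions, so Gamma is the semidirect product of the free group F on
   [w, s_0, s_1] by the infinite cyclic group generated by [x].

   For 0 <= r < 1 the kernel [r ^ d(u, v)] on the Cayley tree of F is the Gram
   kernel of the functions [f] on F with finite norm
     [f(root)^2 + sum_(v != root) (f v - r f (parent v))^2 / (1 - r^2)],
   and this norm is invariant under translations: moving the root along one
   edge does not change it. Inducing to Gamma, one gets an isometric action of
   Gamma on a space of functions on [Z * F] by permutation of the arguments.
   The vectors [r ^ |v|] spread evenly over the window [0 <= l < N] of Z
   become almost invariant when N tends to infinity and r to 1, and their matrix
   coefficients vanish at infinity because Gamma acts freely on [Z * F].
   Summing over a sequence of such (N, r) that converges fast enough gives a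
   formal vector [xi] such that [g xi - xi] is square summable for each [g] and
   tends to infinity with [g]; the action [f |-> g (f + xi) - xi] is affine,
   isometric and metrically proper. *)

Set Implicit Arguments.
Unset Strict Implicit.
Unset Printing Implicit Defensive.

Import Order.TTheory GRing.Theory Num.Theory.
Import numFieldNormedType.Exports.

Local Open Scope classical_set_scope.
Local Open Scope quotient_scope.
Local Open Scope ring_scope.

(** * Square-summable functions *)

Section SquareSum.
Context {R : realType} {T : choiceType}.
Implicit Types f g h : T -> R.

Definition sqsum f : \bar R := \esum_(i in [set: T]) ((f i) ^+ 2)%:E.

Lemma sqsum_ge0 f : (0 <= sqsum f)%E.
Proof. by apply: esum_ge0 => i _; rewrite lee_fin sqr_ge0. Qed.

Lemma esumZ (k : R) (a : T -> R) : 0 <= k ->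
  (\esum_(i in [set: T]) (k * a i)%:E =
   k%:E * \esum_(i in [set: T]) (a i)%:E)%E.
Proof.
move=> k0; rewrite /esum -ereal_supZl //; last first.
  by apply/set0P; exists 0%E, set0; [exact: fsets_set0|rewrite fsbig_set0].
congr ereal_sup; rewrite image_comp; apply: eq_imagel => A [finA _] /=.
by rewrite !fsbig_finite//= !sumEFin -EFinM mulr_sumr.
Qed.

Lemma sqsumZ (k : R) f : sqsum (k *: f)%R = ((k ^+ 2)%:E * sqsum f)%E.
Proof.
rewrite /sqsum -esumZ ?sqr_ge0//; apply: eq_esum => i _.
by rewrite /= -exprMn.
Qed.

Lemma sqsum_finite_le f (M : R) :
  (forall s : seq T, uniq s -> \sum_(i <- s) (f i) ^+ 2 <= M) ->
  (sqsum f <= M%:E)%E.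
Proof.
move=> fM; apply: ge_ereal_sup => _ [A [finA _] <-].
by rewrite fsbig_finite//= sumEFin lee_fin fM.
Qed.

Lemma sum_le_sqsum f (s : seq T) : uniq s ->
  ((\sum_(i <- s) (f i) ^+ 2)%:E <= sqsum f)%E.
Proof.
move=> us; apply: esum_ge; exists [set` s]; first by split=> //; exact: finite_seq.
by rewrite -fsbig_seq// sumEFin.
Qed.

Lemma sqsum_eq0 f : sqsum f = 0%E -> f = 0.
Proof.
move=> f0; apply/funext => i; have := @sum_le_sqsum f [:: i] isT.
by rewrite f0 big_seq1 lee_fin real_exprn_even_le0//= ?num_real// => /eqP.
Qed.

Lemma sqsum_parallelogram f g :
  (sqsum (f + g)%R + sqsum (f - g)%R = 2%:E * (sqsum f + sqsum g))%E.
Proof.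
rewrite /sqsum -!esumD; do ?by move=> i _; rewrite lee_fin sqr_ge0.
under [in RHS]eq_esum do rewrite -EFinD.
rewrite -esumZ//; apply: eq_esum => i _.
by rewrite -EFinD /=; congr EFin; rewrite !fctE; ring.
Qed.

Lemma sqsumD_le f g : (sqsum (f + g)%R <= 2%:E * (sqsum f + sqsum g))%E.
Proof. by rewrite -sqsum_parallelogram leeDl// sqsum_ge0. Qed.

Definition l2_pred : {pred T -> R} := fun f => (sqsum f < +oo)%E.

Lemma l2_submod_closed : submod_closed l2_pred.
Proof.
split=> [|k f g]; rewrite !unfold_in /=.
  by rewrite /sqsum esum1// => i _; rewrite expr0n.
move=> fl gl; apply: le_lt_trans (sqsumD_le _ _) _.
rewrite sqsumZ lte_mul_pinfty// lte_add_pinfty// lte_mul_pinfty//.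
by rewrite lee_fin sqr_ge0.
Qed.

HB.instance Definition _ := GRing.isSubmodClosed.Build R (T -> R) l2_pred
  l2_submod_closed.

End SquareSum.
Arguments sqsum {R T} f%_R.

(** * The Hilbert space of square-summable functions *)

Record l2 (R : realType) (T : choiceType) := L2 {
  l2val :> T -> R;
  l2valP : l2val \in l2_pred }.

Section L2.
Context {R : realType} {T : choiceType}.
Local Notation H := (l2 R T).

HB.instance Definition _ := [isSub for @l2val R T].
HB.instance Definition _ := [Choice of H by <:].
HB.instance Definition _ := [SubChoice_isSubLmodule of H by <:].

Implicit Types u v w : H.

Definition norm2 u : R := fine (sqsum u).

Lemma norm2E u : (norm2 u)%:E = sqsum u.
Proof.
rewrite fineK// ge0_fin_numE ?sqsum_ge0//; exact: l2valP.
Qed.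

Lemma norm2_ge0 u : 0 <= norm2 u.
Proof. by rewrite -lee_fin norm2E sqsum_ge0. Qed.

Lemma norm2Z (k : R) u : norm2 (k *: u) = k ^+ 2 * norm2 u.
Proof. by apply/EFin_inj; rewrite EFinM !norm2E -sqsumZ. Qed.

Lemma norm2_eq0 u : norm2 u = 0 -> u = 0.
Proof.
by move=> u0; apply/val_inj/sqsum_eq0; rewrite -norm2E u0.
Qed.

(** Polarization instead of a sum of products: bilinearity then reduces to identities between sums
    of nonnegative terms, which need no separate summability argument. *)
Definition l2dot u v : R := (norm2 (u + v) - norm2 u - norm2 v) / 2.

Lemma l2dotC u v : l2dot u v = l2dot v u.
Proof. by rewrite /l2dot (addrC u) addrAC. Qed.

Lemma l2dotDl u v w : l2dot (u + v) w = l2dot u w + l2dot v w.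
Proof.
(* The identity is arranged without subtraction, so that it can be checked termwise in the extended
   reals. *)
suff : norm2 (u + v + w) + (norm2 u + (norm2 v + norm2 w)) =
       norm2 (u + v) + (norm2 (u + w) + norm2 (v + w)).
  by rewrite /l2dot; lra.
apply/EFin_inj; rewrite !EFinD !norm2E /sqsum.
rewrite -!esumD; do ?by move=> i _; rewrite -?EFinD lee_fin ?addr_ge0 ?sqr_ge0.
by apply: eq_esum => i _; rewrite -!EFinD /= !fctE; congr EFin; ring.
Qed.

Lemma l2dotZl (k : R) u v : l2dot (k *: u) v = k * l2dot u v.
Proof.
(* A nonnegative [k] keeps all terms nonnegative below; a negative [k] follows from additivity, as
   [k *: u] and [- k *: u] add up to zero. *)
wlog k0 : k / 0 <= k => [hw|].
  have [|k0] := leP 0 k; first exact: hw.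
  have hN : l2dot (k *: u) v + l2dot (- k *: u) v = 0.
    rewrite -l2dotDl -scalerDl subrr scale0r /l2dot add0r.
    have -> : norm2 0 = 0 :> R by rewrite -(scale0r 0) norm2Z expr0n mul0r.
    by rewrite subr0 subrr mul0r.
  have := hw (- k); rewrite oppr_ge0 (ltW k0) => /(_ isT) E.
  by move: hN; rewrite E mulNr => /eqP; rewrite subr_eq0 => /eqP.
suff : norm2 (k *: u + v) + (k * norm2 u + k * norm2 v) =
       k * norm2 (u + v) + (norm2 (k *: u) + norm2 v).
  by rewrite /l2dot; lra.
apply/EFin_inj; rewrite !EFinD !(EFinM k) !norm2E /sqsum -!esumZ//.
rewrite -!esumD; do ?by move=> i _; rewrite -?EFinD lee_fin
  ?addr_ge0// ?(mulr_ge0 k0)// ?sqr_ge0.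
apply: eq_esum => i _; rewrite -!EFinD /= !fctE.
by congr EFin; rewrite /GRing.scale/=; ring.
Qed.

Lemma l2dotuu u : l2dot u u = norm2 u.
Proof. by rewrite /l2dot -mulr2n -scaler_nat norm2Z; lra. Qed.

Definition l2norm u : R := Num.sqrt (norm2 u).

Lemma sqr_l2norm u : l2norm u ^+ 2 = norm2 u.
Proof. by rewrite sqr_sqrtr ?norm2_ge0. Qed.

Lemma l2normZ (k : R) u : l2norm (k *: u) = `|k| * l2norm u.
Proof. by rewrite /l2norm norm2Z sqrtrM ?sqr_ge0// sqrtr_sqr. Qed.

Lemma l2norm_eq0 u : l2norm u = 0 -> u = 0.
Proof. by move=> u0; apply: norm2_eq0; rewrite -sqr_l2norm u0 expr0n. Qed.

(** Cauchy-Schwarz: with [a], [b] the norms of [u], [v] and [d] their product, the vector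
    [b u - a v] has square norm [2 a b (a b - d)], which is nonnegative. *)
Lemma l2dot_le u v : l2dot u v <= l2norm u * l2norm v.
Proof.
have dot0 w : l2dot 0 w = 0 by rewrite -(scale0r 0) l2dotZl mul0r.
have nge0 w : 0 <= l2norm w by exact: sqrtr_ge0.
have [/eqP/l2norm_eq0->|u0] := boolP (l2norm u == 0).
  by rewrite dot0 mulr_ge0.
have [/eqP/l2norm_eq0->|v0] := boolP (l2norm v == 0).
  by rewrite l2dotC dot0 mulr_ge0.
have u1 : 0 < l2norm u by rewrite lt_def u0 nge0.
have v1 : 0 < l2norm v by rewrite lt_def v0 nge0.
have := norm2_ge0 (l2norm v *: u + (- l2norm u) *: v).
rewrite -l2dotuu !(l2dotDl, l2dotZl) !(l2dotC _ (_ + _)) !(l2dotDl, l2dotZl).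
rewrite (l2dotC v u) !l2dotuu -!sqr_l2norm.
set a := l2norm u in u1 *; set b := l2norm v in v1 *; set d := l2dot u v => h.
have {}h : 0 <= (a * b) * (a * b - d) by nra.
by move: h; rewrite pmulr_rge0 ?mulr_gt0// subr_ge0.
Qed.

Lemma ler_l2normD u v : l2norm (u + v) <= l2norm u + l2norm v.
Proof.
have nge0 w : 0 <= l2norm w by exact: sqrtr_ge0.
rewrite -(@ler_pXn2r _ 2)// ?nnegrE ?addr_ge0// sqrrD !sqr_l2norm.
by have := l2dot_le u v; rewrite /l2dot; lra.
Qed.

HB.instance Definition _ :=
  @Lmodule_isNormed.Build R H l2norm ler_l2normD l2normZ l2norm_eq0.

Lemma l2_normE u : `|u| ^+ 2 = norm2 u.
Proof. exact: sqr_l2norm. Qed.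

Lemma l2_coord_le u i : `|u i| <= `|u|.
Proof.
rewrite -(@ler_pXn2r _ 2)// ?nnegrE// l2_normE -lee_fin norm2E.
apply: le_trans (@sum_le_sqsum R T u [:: i] isT).
by rewrite big_seq1 real_normK ?num_real.
Qed.

(** Coordinates are 1-Lipschitz, so the filter has a pointwise limit [f]. A bound on the finite
    partial sums of the squares of [u - v] survives the limit in [v], which bounds the distance from
    [u] to [f]. *)
Lemma l2_complete (F : set_system H) : ProperFilter F -> cauchy F -> cvg F.
Proof.
move=> FF /cauchy_ballP Fc.
have Fd e : 0 < e -> exists2 A, F A & forall u v, A u -> A v -> `|u - v| < e.
  move=> /Fc [[A B] /= [FA FB] AB].
  exists (A `&` B); first exact: filterI.
  by move=> u v [Au _] [_ Bv]; have := AB (u, v) (conj Au Bv); rewrite -ball_normE.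
have Fi i : cvg ((fun u : H => (u i : R)) @ F).
  apply: cauchy_cvg; apply: cauchy_exP => e e0.
  have [A FA Ae] := Fd e e0; have [u Au] := filter_ex FA; exists (u i).
  change (F [set v : H | ball (u i : R) e (v i)]).
  apply: filterS FA => v Av; rewrite -ball_normE /=.
  exact: le_lt_trans (l2_coord_le (u - v) i) (Ae _ _ Au Av).
pose f i := lim ((fun u : H => (u i : R)) @ F).
have near_f e : 0 < e ->
    exists2 A, F A & forall u, A u -> (sqsum (\val u - f)%R <= (e ^+ 2)%:E)%E.
  move=> e0; have [A FA Ae] := Fd e e0; exists A => // u Au.
  apply: sqsum_finite_le => s us.
  have cs : (fun v : H => \sum_(i <- s) (u i - v i) ^+ 2) @ F -->
      \sum_(i <- s) ((\val u - f) i) ^+ 2.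
    elim: s {us} => [|i s IHs].
      by under eq_fun do rewrite big_nil; rewrite big_nil; exact: cvg_cst.
    under eq_fun do rewrite big_cons expr2; rewrite big_cons expr2.
    apply: cvgD; [|exact: IHs].
    suff ci : (fun v : H => u i - v i) @ F --> (\val u - f) i.
      exact: (cvgM ci ci).
    by apply: cvgB; [exact: cvg_cst|exact: Fi].
  apply: (cvgr_to_le cs); apply: filterS FA => v Av.
  rewrite (@le_trans _ _ (norm2 (u - v)))//.
    by rewrite -lee_fin norm2E; apply: sum_le_sqsum.
  by rewrite -l2_normE ler_pXn2r ?nnegrE ?(ltW e0)//; apply/ltW/Ae.
have fl2 : f \in l2_pred.
  have [A FA Af] := near_f 1 ltr01.
  have [u Au] := filter_ex FA.
  rewrite (_ : f = \val u - (\val u - f)); last by rewrite opprB addrC subrK.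
  apply: rpredB; first exact: l2valP.
  by rewrite unfold_in; apply: le_lt_trans (Af _ Au) (ltry _).
apply/cvg_ex; exists (L2 fl2); apply/cvgrPdist_le => e e0.
have [A FA Af] := near_f e e0.
apply: filterS FA => u Au; rewrite distrC -(@ler_pXn2r _ 2)// ?nnegrE ?(ltW e0)//.
by rewrite l2_normE -lee_fin norm2E; exact: Af.
Qed.

HB.instance Definition _ := Uniform_isComplete.Build H l2_complete.

Lemma l2dot_bilinear : bilinear_for
  (GRing.Scale.Law.clone _ _ *%R _) (GRing.Scale.Law.clone _ _ (idfun \; *%R) _)
  l2dot.
Proof.
split=> u k v w; first by rewrite l2dotDl l2dotZl.
by rewrite l2dotC l2dotDl l2dotZl ![l2dot _ u]l2dotC.
Qed.

HB.instance Definition _ :=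
  bilinear_isBilinear.Build R H H R *%R (idfun \; *%R) l2dot l2dot_bilinear.

Lemma l2dot_sym u v : l2dot u v = (-1) ^+ false * idfun (l2dot v u).
Proof. by rewrite mul1r l2dotC. Qed.

HB.instance Definition _ :=
  isHermitianSesquilinear.Build R H false idfun l2dot l2dot_sym.

Lemma l2dot_gt0 u : u != 0 -> 0 < l2dot u u.
Proof.
move=> u0; rewrite l2dotuu lt_def norm2_ge0 andbT.
by apply: contraNneq u0 => /norm2_eq0->.
Qed.

HB.instance Definition _ := isDotProduct.Build R H l2dot l2dot_gt0.

End L2.

(** * Quadratic forms on the Cayley tree of a free group *)

Section ReducedWords.
Variable X : choiceType.
Implicit Types (c l : X * bool) (v : word X).

Definition reduced v := sorted (fun a b => b != linv a) v.

(* The last letter of a word is the leftmost factor of the group element, so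
   that [push] is a left multiplication and [behead] goes towards the root. *)
Fixpoint push c v : word X :=
  if v is l :: u then
    if nilp u && (l == linv c) then [::] else l :: push c u
  else [:: c].

Lemma eq_linv c l : (c == linv l) = (l == linv c).
Proof. by rewrite eq_sym (inv_eq (@linvK X)). Qed.

Lemma push_reduced c v : reduced v -> reduced (push c v).
Proof.
elim: v => [//|l [|l' u] IH] /=.
  by case: ifPn => //=; rewrite /reduced /= eq_linv => ->.
rewrite /reduced /= => /andP[ll' red]; have /= := IH red.
by case: ifP => //= _; rewrite /reduced /= ll'.
Qed.

Lemma pushK c v : reduced v -> push (linv c) (push c v) = v.
Proof.
elim: v => [|l [|l' u] IH] /=; first by rewrite linvK eqxx.
  by case: ifPn => /= [/eqP->//|]; rewrite linvK eqxx.
rewrite /reduced /= => /andP[ll' red]; have /= := IH red.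
case: ifPn => [/andP[/nilP-> /eqP l'c] _ /=|_ /= ->//].
(* Here the tail has been cancelled and [l] is left alone; it would be cancelled in turn only if
   [l = c], but then [l] and [l'] were already inverse. *)
rewrite linvK l'c; case: eqP => // lc.
by rewrite l'c lc eqxx in ll'.
Qed.

Record rword := RWord { rval :> seq (X * bool); rvalP : reduced rval }.

HB.instance Definition _ := [isSub for rval].
HB.instance Definition _ := [Choice of rword by <:].

Implicit Types w : rword.

Definition rroot : rword := RWord (isT : reduced [::]).
Definition rletter l : rword := RWord (isT : reduced [:: l]).

Lemma behead_reduced v : reduced v -> reduced (behead v).
Proof. by case: v => // l v /path_sorted. Qed.

Definition parent w : rword := RWord (behead_reduced (rvalP w)).

Definition act c w : rword := RWord (push_reduced c (rvalP w)).

Lemma actK c : cancel (act c) (act (linv c)).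
Proof. by move=> w; apply: val_inj; exact: pushK (rvalP w). Qed.

Lemma actVK c : cancel (act (linv c)) (act c).
Proof. by move=> w; rewrite -{1}[c]linvK actK. Qed.

Lemma act_root c : act c rroot = rletter c.
Proof. exact: val_inj. Qed.

Lemma act_letter c : act c (rletter (linv c)) = rroot.
Proof. by apply: val_inj; rewrite /= eqxx. Qed.

Lemma parent_letter l : parent (rletter l) = rroot.
Proof. exact: val_inj. Qed.

Lemma size_rval w : w != rroot -> size w = (size (parent w)).+1.
Proof. by case: w => -[|l v] // i; rewrite -val_eqE. Qed.

Lemma parent_act c w : w != rroot -> w != rletter (linv c) ->
  parent (act c w) = act c (parent w).
Proof.
move=> w0 wc; apply: val_inj; case: w w0 wc => -[|l [|l' v]] // i _.
by rewrite -!val_eqE /= eqseq_cons andbT => /negPf ->.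
Qed.

Lemma act_neq_root c w : w != rletter (linv c) -> act c w != rroot.
Proof.
by apply: contraNneq => /(congr1 (act (linv c))); rewrite actK act_root => ->.
Qed.

Definition actw (u : word X) w := foldr act w u.

Lemma actw_cat u v w : actw (u ++ v) w = actw u (actw v w).
Proof. exact: foldr_cat. Qed.

Lemma actwK u : cancel (actw u) (actw (winv u)).
Proof.
move=> w; elim: u => // l u IH.
by rewrite /winv /= rev_cons -cats1 actw_cat /= actK IH.
Qed.

Lemma actwVK u : cancel (actw (winv u)) (actw u).
Proof. by move=> w; rewrite -{1}[u]winvK actwK. Qed.

End ReducedWords.

(** * The translation-invariant form on functions on the tree *)

Section TreeForm.
Variables (R : realType) (X : choiceType) (r : R).
Hypothesis r01 : 0 <= r < 1.
Local Notation F := (rword X).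
Implicit Types (h : F -> R) (c : X * bool) (v : F).

Local Notation s := (Num.sqrt (1 - r ^+ 2)).

Let s_gt0 : 0 < s.
Proof. by case/andP: r01 => r0 r1; rewrite sqrtr_gt0; nra. Qed.

Let sE : s ^+ 2 = 1 - r ^+ 2.
Proof. by case/andP: r01 => r0 r1; rewrite sqr_sqrtr//; nra. Qed.

(** The signed square roots of the terms of the tree norm, so that this norm is
    [sqsum (treeD h)]. *)
Definition treeD h v : R :=
  if v == rroot X then h v else (h v - r * h (parent v)) / s.

Lemma treeD_linear k h g : treeD (k *: h + g) = k *: treeD h + treeD g.
Proof.
apply/funext => v; rewrite /treeD !fctE; case: ifP => // _.
by rewrite /GRing.scale /=; field; rewrite gt_eqF.
Qed.

Lemma treeD0 : treeD 0 = 0.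
Proof.
apply/funext => v; rewrite /treeD.
by case: ifP => _; rewrite ?(mulr0, subr0, mul0r).
Qed.

(** Solves [treeD] for the function along the path from the root; [n] is the depth of the vertex. *)
Fixpoint treeE_rec n h v : R :=
  if n is n'.+1 then r * treeE_rec n' h (parent v) + s * h v else h v.

Definition treeE h v := treeE_rec (size v) h v.

Lemma treeEK h : treeD (treeE h) = h.
Proof.
apply/funext => v; rewrite /treeD /treeE; case: eqVneq => [->//|/size_rval->/=].
by field; rewrite gt_eqF.
Qed.

Lemma treeDK h : treeE (treeD h) = h.
Proof.
apply/funext => v; rewrite /treeE.
move: {-1}(size v) (erefl (size v)) => n; elim: n v => [|n IH] v /= vn.
  by rewrite /treeD; case: v vn => -[].
have v0 : v != rroot X by case: v vn => -[].
rewrite IH; last by move: vn; rewrite size_rval// => -[].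
by rewrite /treeD (negPf v0); field; rewrite gt_eqF.
Qed.

Lemma esum_set2 (T : choiceType) (a b : T) (f : T -> \bar R) : a != b ->
  (forall i, 0 <= f i)%E -> (\esum_(i in [set a; b]) f i = f a + f b)%E.
Proof.
move=> ab f0; rewrite (esumID [set a])// (_ : _ `&` [set a] = [set a]).
  rewrite (_ : _ `&` _ = [set b]) ?esum_set1//.
  apply/seteqP; split=> [x /= [[]//]|x /= ->]; split; first by right.
  by apply/eqP; rewrite eq_sym.
by apply/seteqP; split=> [x /= []|x /= ->]//; split; [left|].
Qed.

Lemma sqsum_split2 (a b : F) h : a != b ->
  sqsum h = ((h a ^+ 2 + h b ^+ 2)%:E +
    \esum_(v in ~` [set a; b]) (h v ^+ 2)%:E)%E.
Proof.
move=> ab; rewrite /sqsum (esumID [set a; b]); last first.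
  by move=> i _; rewrite lee_fin sqr_ge0.
by rewrite !setTI esum_set2// => i; rewrite lee_fin sqr_ge0.
Qed.

(* On the two ends of the edge along which the root moves, the form is
   [(f v ^+ 2 - 2 * r * f v * f p + f p ^+ 2) / (1 - r ^+ 2)], symmetric in
   [v] and [p]; elsewhere the action commutes with [parent]. *)
Lemma sqsum_treeD_act c h : sqsum (treeD (h \o act c)) = sqsum (treeD h).
Proof.
have lr l : rletter l != rroot X by [].
rewrite (@sqsum_split2 (rroot X) (rletter (linv c))) 1?eq_sym//.
rewrite [RHS](@sqsum_split2 (rroot X) (rletter c)) 1?eq_sym//; congr (_ + _)%E.
  congr EFin; rewrite /treeD !eqxx !(negPf (lr _)) /= act_letter !parent_letter.
  rewrite act_root !expr_div_n sE; field.
  by apply/eqP => e; have := s_gt0; rewrite e sqrtr0 ltxx.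
rewrite [RHS](reindex_esum (~` [set rroot X; rletter (linv c)]) _ (act c)).
  apply: eq_esum => v /= nv.
  have v0 : v != rroot X by apply/eqP => e; apply: nv; left.
  have vc : v != rletter (linv c) by apply/eqP => e; apply: nv; right.
  by rewrite /treeD (negPf v0) (negPf (act_neq_root vc)) parent_act.
split=> [v nv|v1 v2 _ _|v nv] /=.
- case=> e; apply: nv; [right|left].
    by rewrite -[v](actK c) e act_root.
  by rewrite -[v](actK c) e -{2}[c]linvK act_letter.
- exact: can_inj (actK c) _ _.
- exists (act (linv c) v); last by rewrite actVK.
  case=> e; apply: nv; [right|left].
    by rewrite -[v](actVK c) e act_root.
  by rewrite -[v](actVK c) e act_letter.
Qed.

Lemma sqsum_treeD_actw u h : sqsum (treeD (h \o actw u)) = sqsum (treeD h).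
Proof.
elim: u h => [|c u IH] h //.
by rewrite -(sqsum_treeD_act c h) -(IH (h \o act c)).
Qed.

Definition geom v : R := r ^+ size v.

(** Each step away from the root multiplies [geom] by [r], so only the root contributes and [geom]
    is a unit vector. *)
Lemma treeD_geom v : treeD geom v = (v == rroot X)%:R.
Proof.
rewrite /treeD /geom; case: eqVneq => [->|/size_rval->]; first by rewrite expr0.
by rewrite exprS subrr mul0r.
Qed.

Lemma size_act c v : v != rroot X -> v != rletter (linv c) ->
  size (act c v) = (size (act c (parent v))).+1.
Proof. by move=> v0 vc; rewrite (size_rval (act_neq_root vc)) parent_act. Qed.

(** These are the kernel vectors of two adjacent vertices, unit vectors with inner product [r]. In
    coordinates, the root gives [(r - 1)^2], its neighbour [linv c] gives [1 - r^2], and all else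
    vanishes. *)
Lemma sqsum_geom_act c :
  sqsum (treeD (geom \o act c - geom)) = (2 * (1 - r))%:E.
Proof.
have lr l : rletter l != rroot X by [].
have -> : treeD (geom \o act c - geom) = treeD (geom \o act c) - treeD geom.
  by rewrite addrC -scaleN1r treeD_linear scaleN1r addrC.
rewrite (@sqsum_split2 (rroot X) (rletter (linv c))) 1?eq_sym// esum1; last first.
  move=> v /= nv.
  have v0 : v != rroot X by apply/eqP => e; apply: nv; left.
  have vc : v != rletter (linv c) by apply/eqP => e; apply: nv; right.
  rewrite !fctE treeD_geom (negPf v0) subr0 /treeD (negPf v0) /= /geom size_act//.
  by rewrite (exprS r) subrr mul0r expr0n.
rewrite adde0 !fctE !treeD_geom eqxx (negPf (lr _)) /treeD eqxx (negPf (lr _)).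
rewrite /= act_letter parent_letter act_root /geom /= expr0 expr1 subr0.
rewrite expr_div_n sE; congr EFin; field.
by apply/eqP => e; have := s_gt0; rewrite e sqrtr0 ltxx.
Qed.

(** One letter at a time, doubling the bound at each step: the factor of [1 - r] obeys
    [a_(n+1) = 2 * (2 + a_n)] with [a_0 = 0]. The growth in the length is harmless because [r] is
    chosen afterwards. *)
Lemma sqsum_geom_actw u : (sqsum (treeD (geom \o actw u - geom)%R) <=
  (4 * (2 ^+ size u - 1) * (1 - r))%:E)%E.
Proof.
elim: u => [|c u IH].
  rewrite (subrr geom) /= expr0 (subrr 1) mulr0 mul0r treeD0.
  by rewrite /sqsum esum1// => v _; rewrite expr0n.
have -> : treeD (geom \o actw (c :: u) - geom) =
    treeD ((geom \o act c - geom) \o actw u) + treeD (geom \o actw u - geom).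
  rewrite -[treeD (_ \o actw u)]scale1r -treeD_linear; congr treeD; apply/funext => v.
  by rewrite !fctE /= scale1r addrA subrK.
apply: le_trans (sqsumD_le _ _) _.
rewrite sqsum_treeD_actw sqsum_geom_act.
apply: le_trans (lee_wpmul2l _ (leeD2l _ IH)) _ => //.
by rewrite -EFinD -EFinM lee_fin exprS; lra.
Qed.

End TreeForm.

(** * Affine isometric actions on square-summable functions *)

Section AffineAction.
Variables (R : realType) (J : choiceType) (G : groupType).
Variables (D E : (J -> R) -> (J -> R)) (rho : G -> J -> J) (xi : J -> R).
Hypothesis D_linear : forall k f g, D (k *: f + g) = k *: D f + D g.
Hypotheses (DK : cancel D E) (EK : cancel E D).
Hypothesis rho1 : rho 1%g = id.
Hypothesis rhoM : forall g h, rho (g * h)%g = rho g \o rho h.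
Hypothesis sqsum_rho : forall g f, sqsum (D (f \o rho g)) = sqsum (D f).
Hypothesis xi_rho : forall g, D (xi \o rho g - xi) \in l2_pred.

Local Notation H := (l2 R J).

Let E_linear k f g : E (k *: f + g) = k *: E f + E g.
Proof. by apply: (can_inj DK); rewrite EK D_linear !EK. Qed.

Let lin_proof (g : G) (u : H) : D (E (l2val u) \o rho g^-1%g) \in l2_pred.
Proof. by rewrite unfold_in sqsum_rho EK; exact: l2valP. Qed.

(** A vector of [H] stands for the coordinates [D f] of a function [f], recovered by [E].
    Precomposition reverses products, hence the inverse of [g]. *)
Definition affine_lin g (u : H) : H := L2 (lin_proof g u).

Definition affine_cocycle g : H := L2 (xi_rho g^-1%g).

Definition affine_act g u := affine_lin g u + affine_cocycle g.

Lemma affine_lin_linear g : linear (affine_lin g).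
Proof.
move=> k u v; apply: val_inj => /=; rewrite -D_linear; congr D.
by rewrite E_linear.
Qed.

HB.instance Definition _ g :=
  GRing.isLinear.Build R H H *:%R (affine_lin g) (affine_lin_linear g).

(** The action is the permutation of arguments conjugated by the translation by [xi], whence the
    composition law. Only the differences [xi \o rho g - xi] have to lie in the space, not [xi]
    itself. *)
Lemma affine_actE g u :
  l2val (affine_act g u) = D ((E (l2val u) + xi) \o rho g^-1%g - xi).
Proof.
rewrite /= -[X in X + _]scale1r -D_linear scale1r; congr D.
by apply/funext => j; rewrite !fctE addrA.
Qed.

Lemma affine_act_action : group_action affine_act.
Proof.
split=> [u|g h u]; apply: val_inj.
  by rewrite [LHS]affine_actE invg1 rho1 addrK EK.
rewrite [LHS]affine_actE [RHS]affine_actE affine_actE DK subrK invgM rhoM.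
by congr D.
Qed.

Lemma affine_act_isometry g : isometric_map (affine_act g).
Proof.
move=> u v; rewrite /affine_act opprD addrACA subrr addr0 -linearB.
apply/eqP; rewrite -(@eqrXn2 _ 2)// !l2_normE; apply/eqP/EFin_inj.
by rewrite !norm2E /= sqsum_rho EK.
Qed.

(** If [u] and its image under [g] both have norm at most [M], then, [g] being isometric, it moves
    the origin by at most [2 * M]. That displacement is the cocycle at [g], which is computed from
    the inverse of [g]. *)
Lemma haagerup_of_affine_action :
  (forall M : R,
    finite_set [set g | (sqsum (D (xi \o rho g - xi)%R) <= M%:E)%E]) ->
  haagerup R G.
Proof.
move=> finM; exists H, l2dot, affine_act; split.
- by move=> v; rewrite l2_normE -l2dotuu.
- exact: affine_act_action.
- move=> g; split; last exact: affine_act_isometry.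
  by exists (affine_lin g), (affine_cocycle g).
move=> B [M [_ BM]].
have {BM} : forall v, B v -> `|v| <= `|M| + 1.
  by move=> v /BM; apply; rewrite (le_lt_trans (ler_norm M))// ltrDl.
move: (`|M| + 1) => {}M BM.
apply: sub_finite_set (finite_image (fun g => g^-1)%g (finM ((2 * M) ^+ 2))).
move=> g [_ [[u Bu <-] Bgu]]; exists g^-1%g; last exact: invgK.
have M0 : 0 <= M by exact: le_trans (normr_ge0 _) (BM _ Bu).
have act0 : affine_act g 0 = affine_cocycle g.
  by rewrite /affine_act linear0 add0r.
rewrite /= -[D _]/(l2val (affine_cocycle g)) -norm2E lee_fin -l2_normE -act0.
rewrite ler_pXn2r ?nnegrE ?mulr_ge0//.
rewrite -[affine_act g 0](subrK (affine_act g u)) (le_trans (ler_normD _ _))//.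
rewrite affine_act_isometry sub0r normrN mulr_natl mulr2n lerD//; exact: BM.
Qed.

End AffineAction.

(** * Sums of tree forms over a family of trees *)

Section Forest.
Variables (R : realType) (X I : choiceType) (r : I -> R).
Hypothesis r01 : forall i, 0 <= r i < 1.
Local Notation F := (rword X).
Implicit Types (f g : I * F -> R).

Definition forestD f p := treeD (r p.1) (fun v => f (p.1, v)) p.2.
Definition forestE f p := treeE (r p.1) (fun v => f (p.1, v)) p.2.

Lemma forestD_linear k f g : forestD (k *: f + g) = k *: forestD f + forestD g.
Proof.
apply/funext => -[i v]; rewrite /forestD /= !fctE.
by rewrite -[RHS]/((k *: treeD _ _ + treeD _ _) v) -treeD_linear.
Qed.

Lemma forestD0 : forestD 0 = 0.
Proof.
by apply/funext => -[i v]; rewrite /forestD [fun v => _](_ : _ = 0)// treeD0.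
Qed.

Lemma forestEK : cancel forestE forestD.
Proof.
move=> f; apply/funext => -[i v].
exact: (congr1 (@^~ v) (treeEK (r01 i) (fun v => f (i, v)))).
Qed.

Lemma forestDK : cancel forestD forestE.
Proof.
move=> f; apply/funext => -[i v].
exact: (congr1 (@^~ v) (treeDK (r01 i) (fun v => f (i, v)))).
Qed.

Lemma sqsum_forestD f : sqsum (forestD f) =
  \esum_(i in [set: I]) sqsum (treeD (r i) (fun v => f (i, v))).
Proof.
rewrite /sqsum esum_esum; last by move=> *; rewrite lee_fin sqr_ge0.
rewrite (_ : _ `*`` _ = [set: I * F]); last by apply/seteqP; split.
by [].
Qed.

(** Words act within each tree, where the form is invariant; [p] then only reindexes the outer sum,
    since the ratio is constant along it. *)
Lemma sqsum_forestD_move (p : I -> I) (u : I -> word X) f :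
  bijective p -> (forall i, r (p i) = r i) ->
  sqsum (forestD (f \o (fun j => (p j.1, actw (u j.1) j.2)))) =
  sqsum (forestD f).
Proof.
move=> [q pK qK] rp; rewrite !sqsum_forestD.
rewrite [RHS](reindex_esum [set: I] _ p); last first.
  split=> [//|i j _ _|i _]; first exact: (can_inj pK).
  by exists (q i) => //; exact: qK.
apply: eq_esum => i _; rewrite rp.
exact: (sqsum_treeD_actw (r01 i) (u i) (fun v => f (p i, v))).
Qed.

End Forest.

(** * Free-by-cyclic structure *)

Section PresentedGroupTheory.
Variables (X : choiceType) (rels : seq (word X)).
Local Notation pg := (presented_group rels).

Lemma pi_cat (u v : word X) :
  \pi_pg (u ++ v) = (\pi_pg u * \pi_pg v)%g.
Proof.
apply/eqP; rewrite eq_sym; apply/pg_piP.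
by apply: word_eq_cat; exact: pg_repr.
Qed.

Lemma pi_winv (u : word X) : \pi_pg (winv u) = (\pi_pg u)^-1%g.
Proof.
apply: (@mulgI _ (\pi_pg u)); rewrite mulgV -pi_cat; apply/eqP/pg_piP.
exact: word_eq_mulV.
Qed.

Lemma pi_relator (u : word X) : u \in rels -> \pi_pg u = 1%g.
Proof. by move=> ur; apply/eqP/pg_piP/word_eq_relator. Qed.

(** The universal property of the presentation: letters acting invertibly, with relators acting
    trivially, define an action of the group. *)
Lemma word_eq_foldr (T : Type) (op : X * bool -> T -> T) (u v : word X) :
  (forall l, cancel (op (linv l)) (op l)) ->
  (forall w, w \in rels -> forall t, foldr op t w = t) ->
  word_eq rels u v -> forall t, foldr op t u = foldr op t v.
Proof.
move=> opK oprel; elim=> {u v}.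
- by [].
- by move=> u v _ IH t.
- by move=> u v w _ IH1 _ IH2 t; rewrite IH1.
- by move=> u u' v v' _ IH1 _ IH2 t; rewrite !foldr_cat IH2 IH1.
- by move=> l t /=; exact: opK.
- by move=> w wr t; exact: oprel.
Qed.

End PresentedGroupTheory.

(** * The recurrence for the conjugates [s_l] and its solution in the free group *)

Definition free_w : 'I_3 * bool := (@Ordinal 3 0 isT, false).
Definition free_s0 : 'I_3 * bool := (@Ordinal 3 1 isT, false).
Definition free_s1 : 'I_3 * bool := (@Ordinal 3 2 isT, false).

(** The recurrence has order two, so it runs on pairs [(s_l, s_(l+1))]. Here it is solved for
    [s_(l+2)], and in [alpha_prev] for [s_l]. *)
Definition alpha_next (p : word 'I_3 * word 'I_3) : word 'I_3 * word 'I_3 :=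
  (p.2, [:: free_w] ++ winv p.2 ++ winv p.1 ++ [:: linv free_w]).

Definition alpha_prev (p : word 'I_3 * word 'I_3) : word 'I_3 * word 'I_3 :=
  ([:: linv free_w] ++ winv p.2 ++ [:: free_w] ++ winv p.1, p.1).

Definition alpha_pair (l : int) : word 'I_3 * word 'I_3 :=
  match l with
  | Posz n => iter n alpha_next ([:: free_s0], [:: free_s1])
  | Negz n => iter n.+1 alpha_prev ([:: free_s0], [:: free_s1])
  end.

Definition alpha (l : int) : word 'I_3 := (alpha_pair l).1.

Lemma alpha_pair_next (n : nat) :
  alpha_pair (n%:Z + 1) = alpha_next (alpha_pair n).
Proof. by rewrite -PoszD addn1. Qed.

Lemma alpha_pair_prev (n : nat) :
  alpha_pair (Negz n) = alpha_prev (alpha_pair (Negz n + 1)).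
Proof.
case: n => [//|n]; rewrite (_ : Negz n.+1 + 1 = Negz n) //; lia.
Qed.

Lemma alpha_pairE (l : int) : alpha_pair l = (alpha l, alpha (l + 1)).
Proof.
rewrite /alpha; case: l => n; first by rewrite alpha_pair_next; case: alpha_pair.
by rewrite alpha_pair_prev.
Qed.

(** The recurrence cyclically permuted to [s_(l+1) w^-1 s_(l+2) w s_l = 1], the shape in which the
    third relator acts at level [l]. For [l >= 0] it defines the word at [l + 2], for [l < 0] the
    word at [l]. *)
Lemma alpha_rel (l : int) (v : rword 'I_3) :
  actw (alpha (l + 1)) (act (linv free_w)
    (actw (alpha (l + 2)) (act free_w (actw (alpha l) v)))) = v.
Proof.
rewrite (_ : l + 2 = l + 1 + 1); last by rewrite -addrA.
case: l => n.
  have -> : alpha (n%:Z + 1 + 1) = (alpha_next (alpha_pair n)).2.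
    by rewrite -alpha_pair_next alpha_pairE.
  rewrite alpha_pairE /alpha_next; set p := alpha _; set q := alpha _.
  rewrite [(_, _).1]/= [(_, _).2]/= !actw_cat /= (actK free_w) actwVK.
  by rewrite (actK free_w) actwK.
have -> : alpha (Negz n) = (alpha_prev (alpha_pair (Negz n + 1))).1.
  by rewrite -alpha_pair_prev.
rewrite alpha_pairE /alpha_prev; set p := alpha _; set q := alpha _.
rewrite /= actw_cat /= (actVK free_w) actwVK.
by rewrite (actK free_w) actwVK.
Qed.

(** The hypothesis is the third relator with [y = w^-1 x] and [z = x^-2 w]. Moving the powers of [x]
    past [w] rewrites it as [s_1 w^-1 s_2 w s_0 = 1]. *)
Lemma relator_conj (G : groupType) (x w s : G) : commute x w ->
  (x * (s * (w^-1 * x * (s * (x^-1 * x^-1 * w * s)))) = 1 ->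
  s * s ^ x^-1 = ((s ^ (x^-1 * x^-1))^-1) ^ w)%g.
Proof.
move=> xw rel; have e : (x * s * w^-1 * x * s * x^-1 * x^-1 * w = s^-1)%g.
  by apply/eqP; rewrite -mulg_eq1 -[1%g]rel !mulgA.
have key g : (g * x^-1 * w^-1 * x = g * w^-1)%g.
  by rewrite -(mulgA _ w^-1)%g -(commuteV xw) !mulgA mulgVK.
apply/eqP; rewrite conjVg -mulg_eq1; apply/eqP.
rewrite !conjgE !invgM !invgK !mulgA key.
by rewrite -(mulgV s) -e !mulgA.
Qed.

Section FreeByCyclic.
Local Open Scope group_scope.
Variables (G : groupType) (x w s : G).
Hypothesis xw : commute x w.
Hypothesis rel_s : s * s ^ x^-1 = ((s ^ (x^-1 * x^-1))^-1) ^ w.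

(** This is [x^-l], so that [s ^ shift_pow l] is the conjugate [s_l]. *)
Definition shift_pow (l : int) : G :=
  match l with Posz n => x^-1 ^+ n | Negz n => x ^+ n.+1 end.

Lemma shift_powS l : shift_pow (l + 1)%R = x^-1 * shift_pow l.
Proof.
case: l => [n|[|n]]; first by rewrite -PoszD addn1 /= expgS.
  by rewrite /= expg1 mulVg.
rewrite (_ : (Negz n.+1 + 1)%R = Negz n); last by lia.
by rewrite /= [in RHS]expgS mulKg.
Qed.

Lemma shift_powB l : shift_pow (l - 1)%R = x * shift_pow l.
Proof. by rewrite -[in RHS](subrK 1%R l) shift_powS mulVKg. Qed.

Lemma shift_pow_w l : commute w (shift_pow l).
Proof.
by case: l => n; apply: commuteX; [apply: commuteV|]; apply: commute_sym.
Qed.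

Lemma rel_shift l : s ^ shift_pow l * s ^ shift_pow (l + 1)%R =
  ((s ^ shift_pow (l + 2)%R)^-1) ^ w.
Proof.
rewrite (_ : (l + 2 = l + 1 + 1)%R); last by rewrite -addrA.
rewrite !shift_powS (mulgA x^-1) (conjgM s (x^-1 * x^-1)) (conjgM s x^-1).
rewrite -conjMg rel_s -(conjVg (s ^ _)) -[LHS]conjgM -[RHS]conjgM.
by rewrite shift_pow_w.
Qed.

Definition free_gen (i : 'I_3) : G :=
  match val i with 0 => w | 1 => s | _ => s ^ x^-1 end.

Definition free_letter (l : 'I_3 * bool) : G :=
  if l.2 then (free_gen l.1)^-1 else free_gen l.1.

Lemma free_letterV l : free_letter (linv l) = (free_letter l)^-1.
Proof. by case: l => i []; rewrite /free_letter //= invgK. Qed.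

Definition free_eval (u : word 'I_3) : G :=
  foldr (fun l => *%g (free_letter l)) 1 u.

Lemma free_eval_cat u v : free_eval (u ++ v) = free_eval u * free_eval v.
Proof. by elim: u => [|l u IH] /=; rewrite ?mul1g// IH mulgA. Qed.

Lemma free_eval_winv u : free_eval (winv u) = (free_eval u)^-1.
Proof.
elim: u => [|l u IH]; first by rewrite invg1.
rewrite /winv /= rev_cons -cats1 free_eval_cat IH invgM /= mulg1.
by rewrite free_letterV.
Qed.

(** The conjugates of [s] obey the recurrence that defines [alpha], with the same initial pair; the
    induction runs in both directions from 0. *)
Lemma free_eval_alpha_pair l : free_eval (alpha_pair l).1 = s ^ shift_pow l /\
  free_eval (alpha_pair l).2 = s ^ shift_pow (l + 1)%R.
Proof.
elim/int_rect: l => [|n [IH1 IH2]|n [IH1 IH2]].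
- by rewrite /= /free_letter /free_gen /= !mulg1 conjg1.
- rewrite (_ : n.+1%:Z = (n%:Z + 1)%R); last by lia.
  rewrite alpha_pair_next; split; first by rewrite IH2.
  rewrite !free_eval_cat !free_eval_winv IH1 IH2 /=.
  rewrite /free_letter /free_gen /= !mulg1.
  have := rel_shift n; rewrite (_ : (n%:Z + 2 = n%:Z + 1 + 1)%R); last first.
    by rewrite -addrA.
  move: (s ^ shift_pow n) (s ^ shift_pow (n%:Z + 1)%R)
    (s ^ shift_pow (n%:Z + 1 + 1)%R) => b c d bc.
  rewrite -[RHS](conjgK w) -[d ^ w]invgK -conjVg -bc.
  by rewrite conjgE invgK invgM !mulgA.
- rewrite (_ : (- n.+1%:Z)%R = Negz n) // alpha_pair_prev.
  have e : (Negz n + 1 = - n%:Z)%R by lia.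
  rewrite e; split; last by rewrite -IH1.
  rewrite !free_eval_cat !free_eval_winv IH1 IH2 /=.
  rewrite /free_letter /free_gen /= !mulg1.
  have := rel_shift (Negz n); rewrite (_ : (Negz n + 2 = - n%:Z + 1)%R); last by lia.
  rewrite e.
  move: (s ^ shift_pow (Negz n)) (s ^ shift_pow (- n%:Z)%R)
    (s ^ shift_pow (- n%:Z + 1)%R) => b c d bc.
  by rewrite -[RHS](mulgK c) bc conjgE !mulgA.
Qed.

Lemma free_eval_alpha l : free_eval (alpha l) = s ^ shift_pow l.
Proof. by have [] := free_eval_alpha_pair l. Qed.

(** Factors are multiplied on the right because the head of a reduced word is its rightmost
    factor. *)
Definition rword_eval (v : rword 'I_3) : G :=
  foldr (fun l g => g * free_letter l) 1 v.

Lemma rword_eval_act c v : rword_eval (act c v) = free_letter c * rword_eval v.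
Proof.
rewrite /rword_eval /=; elim: (rval v) => [|l u IH] /=.
  by rewrite mulg1 mul1g.
case: ifPn => [/andP[/nilP-> /eqP->]|_ /=]; last by rewrite IH mulgA.
by rewrite /= mul1g free_letterV mulgV.
Qed.

Lemma rword_eval_actw u v : rword_eval (actw u v) = free_eval u * rword_eval v.
Proof. by elim: u => [|c u IH] /=; rewrite ?mul1g// rword_eval_act IH mulgA. Qed.

(** The normal form [x^-l v] of the semidirect product. *)
Definition orbit_elt (j : int * rword 'I_3) : G :=
  shift_pow j.1 * rword_eval j.2.

Lemma orbit_elt_shift l v : orbit_elt ((l - 1)%R, v) = x * orbit_elt (l, v).
Proof. by rewrite /orbit_elt shift_powB mulgA. Qed.

Lemma orbit_elt_w l v : orbit_elt (l, act free_w v) = w * orbit_elt (l, v).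
Proof. by rewrite /orbit_elt rword_eval_act !mulgA shift_pow_w. Qed.

(** Since [s x^-l = x^-l s_l], the element [s] acts at level [l] through the word for [s_l]. *)
Lemma orbit_elt_alpha l v : orbit_elt (l, actw (alpha l) v) = s * orbit_elt (l, v).
Proof.
rewrite /orbit_elt rword_eval_actw free_eval_alpha conjgE !mulgA.
by rewrite mulgV mul1g.
Qed.

End FreeByCyclic.

(** * The free action of Gamma on countably many copies of [Z * F] *)

Definition gen_x : word 'I_4 := generator (@Ordinal 4 0 isT).
Definition gen_y : word 'I_4 := generator (@Ordinal 4 1 isT).
Definition gen_z : word 'I_4 := generator (@Ordinal 4 2 isT).
Definition gen_t : word 'I_4 := generator (@Ordinal 4 3 isT).

Definition Gamma_rels : seq (word 'I_4) :=
  [:: gen_x ++ gen_y ++ gen_z; gen_x ++ gen_z ++ gen_y;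
      gen_x ++ winv gen_t ++ gen_y ++ winv gen_t ++ gen_z ++ winv gen_t].

Local Notation pg := (presented_group Gamma_rels).

Section GammaMoves.
Local Notation J := ((nat * int) * rword 'I_3)%type.
Implicit Types j : J.

Definition move_shift (d : int) j : J := ((j.1.1, j.1.2 + d), j.2).
Definition move_level (u : int -> word 'I_3) j : J := (j.1, actw (u j.1.2) j.2).

Definition mx := move_shift (-1).
Definition mxV := move_shift 1.
Definition mw := move_level (fun=> [:: free_w]).
Definition mwV := move_level (fun=> [:: linv free_w]).
Definition ms := move_level alpha.
Definition msV := move_level (fun l => winv (alpha l)).

Lemma mxK : cancel mx mxV.
Proof. by move=> [[k l] v]; rewrite /mx /mxV /move_shift /= subrK. Qed.
Lemma mxVK : cancel mxV mx.
Proof. by move=> [[k l] v]; rewrite /mx /mxV /move_shift /= addrK. Qed.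
Lemma mwK : cancel mw mwV.
Proof. by move=> [i v]; rewrite /mw /mwV /move_level /= (actK free_w). Qed.
Lemma mwVK : cancel mwV mw.
Proof. by move=> [i v]; rewrite /mw /mwV /move_level /= (actVK free_w). Qed.
Lemma msK : cancel ms msV.
Proof. by move=> [i v]; rewrite /ms /msV /move_level /= actwK. Qed.
Lemma msVK : cancel msV ms.
Proof. by move=> [i v]; rewrite /ms /msV /move_level /= actwVK. Qed.

(* [y = w^-1 x], [z = x^-2 w] and [t = s^-1] *)
Definition letter_move (l : 'I_4 * bool) : J -> J :=
  match val l.1, l.2 with
  | 0, false => mx
  | 0, true => mxV
  | 1, false => mwV \o mx
  | 1, true => mxV \o mw
  | 2, false => mxV \o mxV \o mw
  | 2, true => mwV \o mx \o mx
  | _, false => msV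
  | _, true => ms
  end.

Lemma letter_moveVK l : cancel (letter_move (linv l)) (letter_move l).
Proof.
case: l => -[[|[|[|n]]] i] [] j; rewrite /letter_move /=;
by rewrite ?(mxK, mxVK, mwK, mwVK, msK, msVK).
Qed.

Lemma letter_move_relators w :
  w \in Gamma_rels -> forall j, foldr letter_move j w = j.
Proof.
rewrite !inE => /or3P[] /eqP-> [[k l] v]; rewrite /= /letter_move /=.
- by congr (_, _, _); [rewrite /=; lia|exact: (actK free_w)].
- by congr (_, _, _); [rewrite /=; lia|exact: (actVK free_w)].
(* Read from the right, the relator visits the levels [l], [l + 2], [l + 1] and returns to [l]; what
   it does on the tree is [alpha_rel]. *)
- rewrite /mx /mxV /mw /mwV /ms /move_shift /move_level /=.
  rewrite (_ : l + 1 + 1 = l + 2); last by rewrite -addrA.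
  by rewrite (_ : l + 2 - 1 = l + 1) ?alpha_rel ?addrK //; lia.
Qed.

Definition rho (g : pg) j : J := foldr letter_move j (repr g).

Lemma rho_pi u j : rho (\pi_pg u) j = foldr letter_move j u.
Proof.
exact: (word_eq_foldr letter_moveVK letter_move_relators (pg_repr _ _)).
Qed.

Lemma rho1 : rho 1%g = id.
Proof. by apply/funext => j; exact: rho_pi. Qed.

Lemma rhoM g h : rho (g * h)%g = rho g \o rho h.
Proof. by apply/funext => j; rewrite [LHS]rho_pi foldr_cat. Qed.

Lemma rho_fst g j : (rho g j).1.1 = j.1.1.
Proof.
rewrite /rho; elim: (repr g) => //= l u <-.
by case: l => -[[|[|[|n]]] i] [].
Qed.

Local Open Scope group_scope.
Let x : pg := \pi_pg gen_x.
Let y : pg := \pi_pg gen_y.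
Let z : pg := \pi_pg gen_z.
Let s : pg := (\pi_pg gen_t)^-1.
Let w : pg := x / y.

Let xyz : x * (y * z) = 1.
Proof.
have := @pi_relator _ Gamma_rels (gen_x ++ gen_y ++ gen_z).
by rewrite !pi_cat; apply; rewrite !inE eqxx.
Qed.

Let xzy : x * (z * y) = 1.
Proof.
have := @pi_relator _ Gamma_rels (gen_x ++ gen_z ++ gen_y).
by rewrite !pi_cat; apply; rewrite !inE eqxx.
Qed.

Let xsyszs : x * (s * (y * (s * (z * s)))) = 1.
Proof.
have := @pi_relator _ Gamma_rels
  (gen_x ++ winv gen_t ++ gen_y ++ winv gen_t ++ gen_z ++ winv gen_t).
by rewrite !pi_cat !pi_winv; apply; rewrite !inE eqxx.
Qed.

Let yE : y = w^-1 * x.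
Proof. by rewrite /w invgF mulgVK. Qed.

Let xy : commute x y.
Proof.
have zE : z = y^-1 * x^-1.
  by rewrite -[LHS](mulKg (x * y)) -mulgA xyz mulg1 invgM.
apply: (@mulIg _ (y^-1 * x^-1)).
rewrite -zE -[LHS]mulgA xyz.
apply: (@mulgI _ y^-1); rewrite mulg1 !mulgA mulVg mul1g.
by apply: (@mulIg _ y); rewrite mulVg -mulgA xzy.
Qed.

Let xw : commute x w.
Proof. by apply: commuteM => //; exact: commuteV. Qed.

Let zE : z = x^-1 * x^-1 * w.
Proof.
have -> : z = y^-1 * x^-1.
  by rewrite -[LHS](mulKg (x * y)) -mulgA xyz mulg1 invgM.
rewrite /w !mulgA mulgVK.
have := commuteV (commute_sym (commuteV xy)); rewrite /commute => -> //.
Qed.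

Let rel_s : s * s ^ x^-1 = ((s ^ (x^-1 * x^-1))^-1) ^ w.
Proof.
by apply: relator_conj xw _; rewrite -yE -zE.
Qed.

Definition tau j : pg := orbit_elt x w s (j.1.2, j.2).

Lemma tau_mx j : tau (mx j) = x * tau j.
Proof. by case: j => -[k l] v; exact: orbit_elt_shift. Qed.

Lemma tau_mw j : tau (mw j) = w * tau j.
Proof. by case: j => -[k l] v; exact: orbit_elt_w. Qed.

Lemma tau_ms j : tau (ms j) = s * tau j.
Proof. by case: j => -[k l] v; apply: orbit_elt_alpha. Qed.

Lemma tau_mxV j : tau (mxV j) = x^-1 * tau j.
Proof. by rewrite -{2}[j]mxVK tau_mx mulKg. Qed.

Lemma tau_mwV j : tau (mwV j) = w^-1 * tau j.
Proof. by rewrite -{2}[j]mwVK tau_mw mulKg. Qed.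

Lemma tau_msV j : tau (msV j) = s^-1 * tau j.
Proof. by rewrite -{2}[j]msVK tau_ms mulKg. Qed.

Lemma tau_letter_move l j : tau (letter_move l j) = \pi_pg [:: l] * tau j.
Proof.
have piV (i : 'I_4) : \pi_pg [:: (i, true)] = (\pi_pg (generator i))^-1.
  by rewrite -pi_winv.
have px n : \pi_pg [:: (@Ordinal 4 0 n, false)] = x.
  by rewrite (bool_irrelevance n isT).
have py n : \pi_pg [:: (@Ordinal 4 1 n, false)] = y.
  by rewrite (bool_irrelevance n isT).
have pz n : \pi_pg [:: (@Ordinal 4 2 n, false)] = z.
  by rewrite (bool_irrelevance n isT).
have pt n : \pi_pg [:: (@Ordinal 4 3 n, false)] = s^-1.
  by rewrite (bool_irrelevance n isT) /s invgK.
by case: l => -[[|[|[|[|n]]]] i] // [];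
  rewrite /letter_move /= ?piV ?(px, py, pz, pt) ?yE ?zE;
  rewrite ?(tau_mx, tau_mw, tau_ms, tau_mxV, tau_mwV, tau_msV);
  rewrite ?invgM ?invgK ?mulgA.
Qed.

Lemma tau_rho g j : tau (rho g j) = g * tau j.
Proof.
rewrite /rho -{2}[g]reprK; elim: (repr g) => [|l u IH]; first by rewrite mul1g.
by rewrite /= tau_letter_move IH mulgA -(pi_cat _ [:: l]).
Qed.

(** [tau] is equivariant from [J] to Gamma acting on itself by left translation, and that action is
    free. *)
Lemma rho_free j g h : rho g j = rho h j -> g = h.
Proof. by move=> /(congr1 tau); rewrite !tau_rho => /mulIg. Qed.

End GammaMoves.

(** * The cocycle *)

Section Sums.
Variable R : realType.

Lemma esum_seq (T : choiceType) (s : seq T) (f : T -> R) : uniq s ->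
  (forall i, 0 <= f i) -> (forall i, i \notin s -> f i = 0) ->
  (\esum_(i in [set: T]) (f i)%:E = (\sum_(i <- s) f i)%:E)%E.
Proof.
move=> us f0 fs; rewrite (esumID [set` s]); last by move=> *; rewrite lee_fin.
rewrite !setTI [X in (_ + X)%E]esum1 ?adde0; last first.
  by move=> i /= /negP /fs ->.
rewrite esum_fset; [|exact: finite_seq|by move=> i _; rewrite lee_fin].
by rewrite -fsbig_seq// sumEFin.
Qed.

Lemma esum_half (c : R) : 0 <= c ->
  (\esum_(k in [set: nat]) (c / (2 ^ (k + 1))%:R)%:E = c%:E)%E.
Proof.
move=> c0; rewrite -nneseries_esumT; last first.
  by move=> n; rewrite lee_fin divr_ge0.
have /cvg_lim := @cvg_geometric_eseries_half R c 0.
by rewrite expr0 divr1; apply.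
Qed.

Lemma exp_small (z : R) : 0 <= z < 1 -> exists n, z ^+ n < 2^-1.
Proof.
move=> /andP[z0 z1].
have /cvgr_lt/(_ (2^-1)) : (GRing.exp z : R ^nat) @ \oo --> 0.
  by apply: cvg_expr; rewrite ger0_norm.
rewrite invr_gt0 ltr0n => /(_ isT) [n _ nz].
by exists n; apply: nz => /=.
Qed.

End Sums.

Lemma finite_size_lt (T : finType) n :
  finite_set [set v : seq T | (size v < n)%N].
Proof.
elim: n => [|n IH]; first by rewrite (_ : mkset _ = set0)//; apply/seteqP; split.
apply: (@sub_finite_set _ _ ([set [::]] `|`
    (fun p => p.1 :: p.2) @` ([set: T] `*` [set v | (size v < n)%N]))).
  by move=> [|a v] /= sv; [left|right; exists (a, v)].
rewrite finite_setU; split => //; apply: finite_image; exact: finite_setX.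
Qed.

Lemma finite_rword_lt n : finite_set [set v : rword 'I_3 | (size v < n)%N].
Proof.
apply: (@finite_preimage _ _ [set v | (size v < n)%N] (@rval 'I_3)).
  by move=> u v _ _; exact: val_inj.
exact: finite_size_lt.
Qed.

Section Cocycle.
Variable R : realType.
Local Notation I := (nat * int)%type.
Local Notation F := (rword 'I_3).
Local Notation J := (I * F)%type.
Implicit Types (i : I) (k : nat) (j : J) (m : J -> J).

Definition width k := (2 ^ (k + 1))%N.

(* Small enough for the bounds of [sqsum_geom_actw] at the levels of the k-th
   window to add up to at most [1 / width k]. *)
Definition decay k : R := (width k)%:R^-1 /
  (1 + \sum_(n <- iota 0 (width k)) 4 * 2 ^+ size (alpha n)).

Definition ratio i : R := 1 - decay i.1.

(** Normalised so that each window carries a unit vector. *)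
Definition amp i : R :=
  if (0 <= i.2 < (width i.1)%:Z) then Num.sqrt (width i.1)%:R^-1 else 0.

Definition xi j : R := amp j.1 * geom (ratio j.1) j.2.

Local Notation D := (forestD ratio).

Lemma width_gt0 k : 0 < (width k)%:R :> R.
Proof. by rewrite ltr0n expn_gt0. Qed.

Lemma sum_alpha_ge0 k :
  0 <= \sum_(n <- iota 0 (width k)) 4 * 2 ^+ size (alpha n) :> R.
Proof. by apply: sumr_ge0 => n _; rewrite mulr_ge0// exprn_ge0. Qed.

Lemma decay_gt0 k : 0 < decay k.
Proof.
by rewrite divr_gt0 ?invr_gt0 ?width_gt0// ltr_pwDl// sum_alpha_ge0.
Qed.

Lemma decay_le1 k : decay k <= 1.
Proof.
rewrite ler_pdivrMr ?mul1r ?ltr_pwDl ?sum_alpha_ge0//.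
apply: (@le_trans _ _ 1); last by rewrite lerDl sum_alpha_ge0.
by rewrite invf_le1 ?width_gt0// ler1n expn_gt0.
Qed.

Lemma ratio01 i : 0 <= ratio i < 1.
Proof. by rewrite /ratio subr_ge0 decay_le1 ltrBlDr ltrDl decay_gt0. Qed.

Lemma amp_sqr i : (0 <= i.2 < (width i.1)%:Z) -> amp i ^+ 2 = (width i.1)%:R^-1.
Proof. by rewrite /amp => ->; rewrite sqr_sqrtr// invr_ge0 ltW// width_gt0. Qed.

Lemma amp_sqr_le1 i : amp i ^+ 2 <= 1.
Proof.
have [wi|/negPf wi] := boolP (0 <= i.2 < (width i.1)%:Z).
  by rewrite amp_sqr// invf_le1 ?width_gt0// ler1n expn_gt0.
by rewrite /amp wi expr0n.
Qed.

Lemma sqsum_forestD_fiber (c : I -> R) (h : I -> F -> R) :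
  sqsum (D (fun j => c j.1 * h j.1 j.2)) =
  (\esum_(i in [set: I]) ((c i ^+ 2)%:E * sqsum (treeD (ratio i) (h i))))%E.
Proof.
rewrite sqsum_forestD; apply: eq_esum => i _; rewrite -sqsumZ; congr sqsum.
by have := treeD_linear (ratio01 i) (c i) (h i) 0; rewrite treeD0 !addr0.
Qed.

(** As [width k] is [2 ^ (k + 1)], the bounds on the windows form a geometric series with sum
    [c]. *)
Lemma esum_levels_lt (b : I -> R) (s : nat -> seq int) (c : R) : 0 <= c ->
  (forall i, 0 <= b i) -> (forall k, uniq (s k)) ->
  (forall k l, l \notin s k -> b (k, l) = 0) ->
  (forall k, \sum_(l <- s k) b (k, l) <= c / (width k)%:R) ->
  (\esum_(i in [set: I]) (b i)%:E < +oo)%E.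
Proof.
move=> c0 b0 us bs bc.
have := @esum_esum R nat int setT (fun=> setT) (fun k l => (b (k, l))%:E).
rewrite (_ : _ `*`` _ = [set: I]); last by apply/seteqP; split.
rewrite (_ : (fun k : I => _) = (fun i => (b i)%:E)); last first.
  by apply/funext => -[].
move=> <-; last by move=> *; rewrite lee_fin.
apply: (@le_lt_trans _ _ c%:E); last exact: ltry.
rewrite -esum_half//; apply: le_esum => k _.
by rewrite (esum_seq (us k) _ (bs k))// lee_fin.
Qed.

(** Both conditions pass to composites and inverses, so only [mx], [mw] and [ms] need a
    computation. *)
Definition l2_move m :=
  (forall f : J -> R, sqsum (D (f \o m)) = sqsum (D f)) /\
  (sqsum (D (xi \o m - xi)%R) < +oo)%E.

Lemma l2_move_id : l2_move id.
Proof.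
split=> //; rewrite (_ : _ - _ = 0); last first.
  by apply/funext => j; rewrite !fctE subrr.
by rewrite forestD0 /sqsum esum1// => j _; rewrite expr0n.
Qed.

Lemma l2_move_comp m1 m2 : l2_move m1 -> l2_move m2 -> l2_move (m1 \o m2).
Proof.
move=> [i1 g1] [i2 g2]; split=> [f|].
  by rewrite -(i1 f) -(i2 (f \o m1)).
have -> : xi \o (m1 \o m2) - xi =
    1 *: ((xi \o m1 - xi) \o m2) + (xi \o m2 - xi).
  by apply/funext => j; rewrite scale1r !fctE addrA subrK.
rewrite forestD_linear; last exact: ratio01.
rewrite scale1r (le_lt_trans (sqsumD_le _ _))// i2.
by rewrite lte_mul_pinfty// lte_add_pinfty.
Qed.

Lemma l2_move_inv m m' : cancel m m' -> cancel m' m -> l2_move m -> l2_move m'.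
Proof.
move=> mK m'K [im gm].
have im' (f : J -> R) : sqsum (D (f \o m')) = sqsum (D f).
  by rewrite -im; congr (sqsum (D _)); apply/funext => j /=; rewrite mK.
split=> //.
have -> : xi \o m' - xi = (-1) *: ((xi \o m - xi) \o m') + 0.
  by apply/funext => j; rewrite scaleN1r !fctE m'K addr0 opprB.
rewrite forestD_linear; last exact: ratio01.
by rewrite forestD0 addr0 sqsumZ sqrrN expr1n mul1e im'.
Qed.

(** Shifting a window changes the amplitude only at its two ends, the levels 0 and [width k]; as
    [geom] is a unit vector, this costs [2 / width k]. *)
Lemma l2_move_mx : l2_move mx.
Proof.
split=> [f|].
  have pK : bijective (fun i : I => (i.1, i.2 - 1)).
    by exists (fun i => (i.1, i.2 + 1)) => -[k l] /=; rewrite ?subrK ?addrK.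
  exact: (sqsum_forestD_move ratio01 (fun=> [::]) f pK (fun=> erefl)).
have -> : xi \o mx - xi =
    (fun j => (amp (j.1.1, j.1.2 - 1) - amp j.1) * geom (ratio j.1) j.2).
  by apply/funext => -[[k l] v]; rewrite !fctE /= /xi /= mulrBl.
rewrite (sqsum_forestD_fiber (fun i => amp (i.1, i.2 - 1) - amp i)
  (fun i => geom (ratio i))).
under eq_esum => i _.
  have -> : sqsum (treeD (ratio i) (geom (X := 'I_3) (ratio i))) = 1%E.
    rewrite /sqsum (@esum_seq R _ [:: rroot 'I_3])//.
    - by rewrite big_seq1 treeD_geom eqxx expr1n.
    - by move=> v; rewrite sqr_ge0.
    - by move=> v; rewrite inE treeD_geom => /negPf->; rewrite expr0n.
  rewrite mule1; over.
pose s k := [:: 0; (width k)%:Z].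
apply: (@esum_levels_lt _ s 2) => //.
- by move=> i; rewrite sqr_ge0.
- by move=> k; rewrite /= inE eq_sym eqz_nat eqn0Ngt expn_gt0.
- move=> k l; rewrite !inE negb_or /amp /= => /andP[l0 lw].
  have -> : (0 <= l - 1 < (width k)%:Z) = (0 <= l < (width k)%:Z) by lia.
  by rewrite subrr expr0n.
- move=> k; rewrite big_cons big_seq1.
  have w0 : (0 < width k)%N by rewrite expn_gt0.
  have -> : amp (k, 0 - 1) = 0 by rewrite /amp /=.
  have -> : amp (k, (width k)%:Z) = 0 by rewrite /amp /= ltxx ?andbF.
  rewrite sub0r sqrrN subr0 !amp_sqr //=; try lia.
  by rewrite mulrDl mul1r.
Qed.

(** The hypothesis lets [decay], which is calibrated on [alpha], also serve for the single letter of
    [mw]; the k-th window then contributes at most [1 / width k]. *)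
Lemma l2_move_level (u : int -> word 'I_3) :
  (forall l, 2 ^+ size (u l) - 1 <= 2 ^+ size (alpha l) :> R) ->
  l2_move (move_level u).
Proof.
move=> ua; split=> [f|].
  have idK : bijective (@id I) by exists id.
  exact: (sqsum_forestD_move ratio01 (fun i => u i.2) f idK (fun=> erefl)).
have -> : xi \o move_level u - xi =
    (fun j => amp j.1 *
      (geom (ratio j.1) \o actw (u j.1.2) - geom (ratio j.1)) j.2).
  by apply/funext => -[[k l] v]; rewrite !fctE /= /xi /= mulrBr.
rewrite (sqsum_forestD_fiber amp
  (fun i => geom (ratio i) \o actw (u i.2) - geom (ratio i))).
pose b i : R := amp i ^+ 2 * (4 * 2 ^+ size (alpha i.2) * decay i.1).
apply: (@le_lt_trans _ _ (\esum_(i in [set: I]) (b i)%:E)%E).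
  apply: le_esum => i _; rewrite /b (EFinM (amp i ^+ 2)).
  rewrite lee_wpmul2l ?lee_fin ?sqr_ge0//.
  apply: le_trans (sqsum_geom_actw (ratio01 i) _) _.
  rewrite lee_fin /ratio opprB addrCA subrr addr0 ler_wpM2r ?ler_wpM2l//.
  exact/ltW/decay_gt0.
have term0 l k : 0 <= 4 * 2 ^+ size (alpha l) * decay k.
  by apply: mulr_ge0; [rewrite mulr_ge0 ?exprn_ge0|exact/ltW/decay_gt0].
apply: (@esum_levels_lt _ (fun k => [seq n%:Z | n <- iota 0 (width k)]) 1) => //.
- by move=> i; rewrite mulr_ge0 ?sqr_ge0.
- by move=> k; rewrite map_inj_uniq ?iota_uniq// => a c [].
- move=> k l lk; rewrite /b /amp /=; case: ifP => [lw|_]; last first.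
    by rewrite expr0n mul0r.
  case/negP: lk; apply/mapP; exists `|l|%N; first by rewrite mem_iota; lia.
  by lia.
- move=> k; rewrite big_map.
  apply: (@le_trans _ _
      (\sum_(n <- iota 0 (width k)) 4 * 2 ^+ size (alpha n) * decay k)).
    by apply: ler_sum => n _; rewrite /b ler_piMl//= amp_sqr_le1.
  rewrite -mulr_suml mul1r /decay mulrCA ger_pMr ?invr_gt0 ?width_gt0//.
  by rewrite ler_pdivrMr ?mul1r ?lerDr// ltr_pwDl ?sum_alpha_ge0.
Qed.

Lemma l2_move_mw : l2_move mw.
Proof.
apply: l2_move_level => l /=; rewrite expr1.
apply: (@le_trans _ _ 1); first lra.
by apply: exprn_ege1; rewrite ler1n.
Qed.

Lemma l2_move_ms : l2_move ms.
Proof. by apply: l2_move_level => l; rewrite gerBl. Qed.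

Lemma l2_move_letter l : l2_move (letter_move l).
Proof.
have gxV := l2_move_inv mxK mxVK l2_move_mx.
have gwV := l2_move_inv mwK mwVK l2_move_mw.
have gsV := l2_move_inv msK msVK l2_move_ms.
have := l2_move_ms; have := l2_move_mx; have := l2_move_mw => gw gen_x gs.
by case: l => -[[|[|[|n]]] i] []; rewrite /letter_move /=; do ?apply: l2_move_comp.
Qed.

Lemma l2_move_rho g : l2_move (rho g).
Proof.
rewrite /rho; elim: (repr g) => [|l u IH]; first exact: l2_move_id.
exact: (l2_move_comp (l2_move_letter l) IH).
Qed.

Lemma finite_rho_to j (T : set J) : finite_set T ->
  finite_set [set g | T (rho g j)].
Proof.
by move=> finT; apply: finite_preimage finT => g h _ _; exact: rho_free.
Qed.

(** A window has finitely many levels, [geom] falls below one half beyond some depth [L], and [F]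
    has finitely many words shorter than [L]. *)
Lemma finite_xi_gt k :
  finite_set [set j | j.1.1 = k /\ Num.sqrt (width k)%:R^-1 / 2 < xi j].
Proof.
have [L rL] := exp_small (ratio01 (k, 0)).
apply: (@sub_finite_set _ _ ((fun p : nat * F => ((k, p.1%:Z), p.2)) @`
  (`I_(width k) `*` [set v : F | (size v < L)%N]))); last first.
  apply/finite_image/finite_setX; [exact: finite_II|exact: finite_rword_lt].
have s0 : 0 < Num.sqrt (width k)%:R^-1 :> R.
  by rewrite sqrtr_gt0 invr_gt0 width_gt0.
move=> [[_ l] v] /= [->]; rewrite /xi /amp /=; case: ifP => [lw|_]; last first.
  by rewrite mul0r ltNge (ltW _)// divr_gt0.
rewrite ltr_pM2l// => rv; exists (`|l|%N, v); last first.
  by rewrite /= gez0_abs//; case/andP: lw.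
split => /=; first by lia.
rewrite ltnNge; apply/negP => Lv; move: rv; rewrite ltNge => /negP; apply.
rewrite /geom; have /andP[r0 r1] := ratio01 (k, 0).
by rewrite (le_trans (ler_wiXn2l r0 (ltW r1) Lv))// ltW.
Qed.

(** A small cocycle forces some window to lose less than a quarter of its mass at the roots, so some
    root of it is sent to a point where [xi] exceeds half the amplitude. There are finitely many
    such points, and by freeness finitely many such [g]. *)
Lemma finite_sqsum_cocycle (M : R) :
  finite_set [set g | (sqsum (D (xi \o rho g - xi)%R) <= M%:E)%E].
Proof.
pose root := rroot 'I_3.
pose q k g := \sum_(n <- iota 0 (width k))
  (xi (rho g ((k, n%:Z), root)) - xi ((k, n%:Z), root)) ^+ 2.
(* Then [K / 4] exceeds [M], so not all of the first [K] windows can contribute a quarter. *)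
pose K := Num.bound (4 * `|M|).
apply: (@sub_finite_set _ _ (\bigcup_(k in `I_K) [set g | q k g < 4^-1])).
  move=> g /= gM; apply: contrapT => nq.
  have {}nq k : (k < K)%N -> 4^-1 <= q k g.
    by move=> kK; rewrite leNgt; apply/negP => qk; apply: nq; exists k.
  (* At a root the coordinate given by [forestD] is the plain value, so these terms of the square
     sum are those of [q]. *)
  have := le_trans (@sum_le_sqsum R _ (D (xi \o rho g - xi))
    [seq ((k, n%:Z), root) | k <- iota 0 K, n <- iota 0 (width k)] _) gM.
  rewrite allpairs_uniq_dep ?iota_uniq//; last 2 first.
  - by move=> k _; exact: iota_uniq.
  - by move=> [k n] [k' n'] _ _ /= [-> ->].
  move=> /(_ isT); rewrite big_allpairs_dep lee_fin.
  apply/negP; rewrite -ltNge.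
  apply: (@lt_le_trans _ _ (\sum_(k <- iota 0 K) 4^-1)).
    rewrite big_const_seq count_predT size_iota iter_addr addr0 -(mulr_natl _ K).
    rewrite ltr_pdivlMr// mulrC (le_lt_trans _ (archi_boundP _))// ?mulr_ge0//.
    by rewrite ler_wpM2l// ler_norm.
  rewrite big_seq [leRHS]big_seq; apply: ler_sum => k; rewrite mem_iota add0n => kK.
  exact: nq.
apply: bigcup_finite => [|k _]; first exact: finite_II.
apply: (@sub_finite_set _ _ (\bigcup_(n in `I_(width k)) [set g |
    [set j | j.1.1 = k /\ Num.sqrt (width k)%:R^-1 / 2 < xi j]
      (rho g ((k, n%:Z), root))])); last first.
  apply: bigcup_finite => [|n _]; first exact: finite_II.
  exact/finite_rho_to/finite_xi_gt.
move=> g /= qk; apply: contrapT => nq; move: qk; apply/negP; rewrite -leNgt.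
have xin n : (n < width k)%N -> xi (k, n%:Z, root) = Num.sqrt (width k)%:R^-1.
  by move=> nk; rewrite /xi /amp /= /geom expr0 mulr1 ltz_nat nk.
(* If every root drops by at least half the amplitude, each of the [width k] squares is at least
   [1 / (4 * width k)]. *)
apply: (@le_trans _ _ (\sum_(n <- iota 0 (width k)) (width k)%:R^-1 / 4)).
  rewrite big_const_seq count_predT size_iota iter_addr addr0 -(mulr_natl (_ / 4)).
  by rewrite mulrA mulfV ?mul1r// gt_eqF// width_gt0.
rewrite big_seq [leRHS]big_seq; apply: ler_sum => n; rewrite mem_iota add0n => nk.
have : xi (rho g (k, n%:Z, root)) <= Num.sqrt (width k)%:R^-1 / 2.
  rewrite leNgt; apply/negP => xg; apply: nq; exists n => //=.
  by split=> //; rewrite rho_fst.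
rewrite xin//.
have := @sqr_sqrtr R (width k)%:R^-1; rewrite invr_ge0 ler0n => /(_ isT).
have : 0 <= Num.sqrt (width k)%:R^-1 :> R by exact: sqrtr_ge0.
by move: (Num.sqrt _) => a a0 <-; move: (xi _) => b ab; nra.
Qed.

End Cocycle.

Theorem theorem0p8 (R : realType) : haagerup R Gamma.
Proof.
apply: (@haagerup_of_affine_action R _ _ (forestD (ratio R)) (forestE (ratio R))
  rho (@xi R)).
- exact/forestD_linear/ratio01.
- exact/forestDK/ratio01.
- exact/forestEK/ratio01.
- exact: rho1.
- exact: rhoM.
- by move=> g; case: (l2_move_rho R g).
- by move=> g; case: (l2_move_rho R g).
- exact: finite_sqsum_cocycle.
Qed.
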